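(* For every $q\in(1/2,1)$ there exists a $2$-action partial monitoring game (with countably infinite latent space $\mathcal Z$) such that, in the standard setting, $$\lim_{n\to\infty}\frac{\log(\mathfrak R_n^\star)}{\log(n)}=q.$$
   Context: A $k$-action partial monitoring game: set $\mathcal Z$, loss $\mathcal L:[k]\times\mathcal Z\to[0,1]$, signal $\mathcal S:[k]\times\mathcal Z\to\Sigma$. $\mathcal K$ = finitely supported probability distributions on $\mathcal Z$; $\mathcal L(a,x)=\sum_zx(z)\mathcal L(a,z)$. Standard setting: interaction over $n$ rounds where an adversary fixes $x_1,\dots,x_n\in\mathcal K$, $z_t\sim x_t$ independently and unobserved; the learner chooses $a_t$ (possibly randomised) based on $a_1,\sigma_1,\dots,a_{t-1},\sigma_{t-1}$ and observes $\sigma_t=\mathcal S(a_t,z_t)$; regret $\mathbb E[\sum_t\mathcal L(a_t,x_t)]-n\min_{a}\mathcal L(a,\frac1n\sum_tx_t)$; $\mathfrak R_n^\star$ = infimum over learners of the supremum over adversary sequences of the regret. *)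

(* Defs.v *)
From HB Require Import structures.
From mathcomp Require Import all_boot all_order all_algebra.
From mathcomp Require Import all_classical all_reals all_analysis.
Set Implicit Arguments. Unset Strict Implicit. Unset Printing Implicit Defensive.
Import Order.TTheory GRing.Theory Num.Theory.
Local Open Scope ring_scope.
Local Open Scope classical_set_scope.

Record fdist (R : realType) := FDist {
  fd :> nat -> R;
  fd_supp : seq nat;
  fd_ge0 : forall z, 0 <= fd z;
  fd_out : forall z, z \notin fd_supp -> fd z = 0;
  fd_sum1 : \sum_(z <- undup fd_supp) fd z = 1 }.

Definition fexp (R : realType) (x : fdist R) (f : nat -> R) : R :=
  \sum_(z <- undup (fd_supp x)) x z * f z.

Definition lossK (R : realType) (L : 'I_2 -> nat -> R) (a : 'I_2) (x : fdist R) : R :=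
  fexp x (L a).

(* A (randomised) learner, in behavioural form: a map from the history
   (a_1, sigma_1, ..., a_{t-1}, sigma_{t-1}) to a probability distribution
   over the actions. *)
Record learner (R : realType) (Sig : Type) := Learner {
  pol :> seq ('I_2 * Sig) -> 'I_2 -> R;
  pol_ge0 : forall h a, 0 <= pol h a;
  pol_sum1 : forall h, \sum_(a : 'I_2) pol h a = 1 }.

(* Expected cumulative loss  E[ sum_{s = t}^{t+m-1} L(a_s, x_s) ]  of the
   learner, from round t on with current history h, where z_s ~ x_s
   independently and the learner observes sigma_s = S(a_s, z_s). *)
Fixpoint cumloss (R : realType) (Sig : Type) (L : 'I_2 -> nat -> R)
  (S : 'I_2 -> nat -> Sig) (pi : learner R Sig) (x : nat -> fdist R)
  (m t : nat) (h : seq ('I_2 * Sig)) : R :=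
  match m with
  | 0 => 0
  | m'.+1 =>
      \sum_(a : 'I_2) pi h a *
        (lossK L a (x t) +
         fexp (x t) (fun z => cumloss L S pi x m' t.+1 (rcons h (a, S a z))))
  end.

Definition min2 (R : realType) (f : 'I_2 -> R) : R :=
  \big[Num.min/f ord0]_(a : 'I_2) f a.

(* Regret over n rounds (rounds indexed 0..n-1):
   E[sum_t L(a_t,x_t)] - n min_a L(a, (1/n) sum_t x_t),
   where L(a, (1/n) sum_t x_t) = (1/n) sum_t L(a, x_t) by linearity of L(a,.). *)
Definition regret (R : realType) (Sig : Type) (L : 'I_2 -> nat -> R)
  (S : 'I_2 -> nat -> Sig) (pi : learner R Sig) (x : nat -> fdist R) (n : nat) : R :=
  cumloss L S pi x n 0 [::]
  - n%:R * min2 (fun a => n%:R^-1 * \sum_(t < n) lossK L a (x t)).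

Definition minimax_regret (R : realType) (Sig : Type) (L : 'I_2 -> nat -> R)
  (S : 'I_2 -> nat -> Sig) (n : nat) : R :=
  inf [set r : R | exists pi : learner R Sig,
         r = sup [set s : R | exists x : nat -> fdist R, s = regret L S pi x n]].

(* Main.v *)
(* Let [beta = 2 q - 1]. The outcomes are the edges of an infinite path whose
   vertices are alternately signals of action 0 and of action 1, and the sign
   of the loss difference alternates along the path, its size at depth [i]
   being [i ^ beta - (i - 1) ^ beta]. The only way to estimate the loss
   difference is to telescope along the path, with values of order [i ^ beta].

   Upper bound: truncate the telescoped estimator at depth [N], about the
   square root of [n]. Shifted to be nonnegative, it turns the game into a
   bandit with losses of range [2 N ^ beta] up to a bias [N ^ (beta - 1)], and
   Exp3 has regret [O(sqrt n * N ^ beta + n * N ^ (beta - 1)) = O(n ^ q)].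

   Lower bound: for [m] of order [sqrt n], let one environment be spread over
   the edges of one sign up to depth [m] and the other over those of the other
   sign. The signals differ only by mass [1 / (2 m)] at both ends, where some
   common mass is added, so that the squared Hellinger distance per round is
   [O(1 / m ^ 2) = O(1 / n)]. The loss gap [m ^ (beta - 1) / 2] is then
   undetectable, and Le Cam's two-point argument gives regret of order
   [n * m ^ (beta - 1) = n ^ q]. *)
Require Import Defs.
From HB Require Import structures.
From mathcomp Require Import all_boot all_order all_algebra.
From mathcomp Require Import all_classical all_reals all_analysis.
From mathcomp Require Import ring lra zify.
Import Order.TTheory GRing.Theory Num.Theory numFieldNormedType.Exports.
Local Open Scope ring_scope.
Local Open Scope classical_set_scope.

(** * Expectations and finitely supported mixtures *)

Section Expectation.
Context {R : realType}.
Implicit Types (x : fdist R) (f g : nat -> R).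

Lemma fexpD x f g : fexp x (fun z => f z + g z) = fexp x f + fexp x g.
Proof. by rewrite /fexp -big_split /=; apply: eq_bigr => z _; rewrite mulrDr. Qed.

Lemma fexpZ x c f : fexp x (fun z => c * f z) = c * fexp x f.
Proof. by rewrite /fexp mulr_sumr; apply: eq_bigr => z _; rewrite mulrCA. Qed.

Lemma fexp_cst x c : fexp x (fun=> c) = c.
Proof. by rewrite /fexp -mulr_suml fd_sum1 mul1r. Qed.

Lemma fexp_le x f g : (forall z, f z <= g z) -> fexp x f <= fexp x g.
Proof. by move=> fg; apply: ler_sum => z _; rewrite ler_wpM2l ?fd_ge0. Qed.

Section Mixture.
Variable s : seq (nat * R).
Hypotheses (s_ge0 : forall i, i \in s -> 0 <= i.2) (s_sum1 : \sum_(i <- s) i.2 = 1).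

(** Masses listed at the same outcome add up, so the listed outcomes need not be shown distinct. *)
Let mass k := \sum_(i <- s) i.2 * (i.1 == k)%:R.

Let mass_ge0 k : 0 <= mass k.
Proof. by rewrite /mass big_seq; apply: sumr_ge0 => i /s_ge0 ?; rewrite mulr_ge0. Qed.

Let mass_out k : k \notin map fst s -> mass k = 0.
Proof.
move=> ks; rewrite /mass big_seq big1// => i si.
have [ik|_] := eqVneq i.1 k; last by rewrite mulr0.
by rewrite -ik map_f in ks.
Qed.

Let mass_exp f :
  \sum_(k <- undup (map fst s)) mass k * f k = \sum_(i <- s) i.2 * f i.1.
Proof.
under eq_bigr do rewrite /mass mulr_suml.
rewrite exchange_big /= !big_seq; apply: eq_bigr => i si.
rewrite (bigD1_seq i.1) ?undup_uniq ?mem_undup ?map_f//= eqxx mulr1.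
by rewrite big1 ?addr0// => k ki; rewrite eq_sym (negPf ki) mulr0 mul0r.
Qed.

Let mass_sum1 : \sum_(k <- undup (map fst s)) mass k = 1.
Proof.
under eq_bigr do rewrite -[mass _]mulr1.
by rewrite (mass_exp (fun=> 1)); under eq_bigr do rewrite mulr1.
Qed.

Definition mixture : fdist R := FDist mass_ge0 mass_out mass_sum1.

Lemma fexp_mixture f : fexp mixture f = \sum_(i <- s) i.2 * f i.1.
Proof. exact: mass_exp. Qed.

End Mixture.
End Expectation.

(** * Regret and its minimax value *)

Section Regret.
Context {R : realType} {Sig : Type} (L : 'I_2 -> nat -> R) (S : 'I_2 -> nat -> Sig).
Implicit Types (pi : learner R Sig) (x : nat -> fdist R).

Lemma min2E (f : 'I_2 -> R) : min2 f = Num.min (f ord0) (f ord_max).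
Proof.
rewrite /min2 big_ord_recl big_ord_recl big_ord0.
rewrite (_ : lift ord0 ord0 = ord_max); last exact: val_inj.
by rewrite [Num.min (f ord_max) _]minC minA minxx.
Qed.

Lemma regretE pi x n :
  regret L S pi x n =
  cumloss L S pi x n 0 [::] - min2 (fun a => \sum_(t < n) lossK L a (x t)).
Proof.
case: n => [|n].
  by rewrite /regret mul0r min2E !big_ord0 minxx.
congr (_ - _); rewrite !min2E minr_pMr//.
by rewrite !mulrA mulfV// !mul1r.
Qed.

Lemma regret_le pi x n B :
  (forall a, cumloss L S pi x n 0 [::] - \sum_(t < n) lossK L a (x t) <= B) ->
  regret L S pi x n <= B.
Proof. by move=> H; rewrite regretE min2E minElt; case: ifP. Qed.

Hypothesis L01 : forall a z, 0 <= L a z <= 1.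

Lemma lossK_ge0 a (x : fdist R) : 0 <= lossK L a x.
Proof. by apply: sumr_ge0 => z _; have /andP[? _] := L01 a z; rewrite mulr_ge0 ?fd_ge0. Qed.

Lemma lossK_le1 a (x : fdist R) : lossK L a x <= 1.
Proof.
by rewrite -[leRHS](fexp_cst x); apply: fexp_le => z; case/andP: (L01 a z).
Qed.

Lemma cumloss_le pi x m t h : cumloss L S pi x m t h <= m%:R.
Proof.
elim: m t h => [|m IH] t h //=.
rewrite -[leRHS]mul1r -[X in _ <= X * _](pol_sum1 pi h) mulr_suml; apply: ler_sum => a _.
rewrite ler_wpM2l ?pol_ge0// -natr1 addrC lerD ?lossK_le1//.
by rewrite -[leRHS](fexp_cst (x t)); apply: fexp_le => z; exact: IH.
Qed.

Lemma regret_le_rounds pi x n : regret L S pi x n <= n%:R.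
Proof.
apply: regret_le => a; rewrite lerBlDr -[leLHS]addr0 lerD ?cumloss_le//.
by apply: sumr_ge0 => t _; exact: lossK_ge0.
Qed.

(** [sup] and [inf] take default values on empty or unbounded sets. Here [regret_le_rounds] bounds
    each inner set above, and [A] bounds the outer set below. *)
Lemma minimax_regret_bounds n A B :
  (forall pi, exists x, A <= regret L S pi x n) ->
  (exists pi, forall x, regret L S pi x n <= B) ->
  A <= minimax_regret L S n <= B.
Proof.
move=> lo [pi0 hi].
have lb : lbound [set r : R | exists pi : learner R Sig,
    r = sup [set s : R | exists x, s = regret L S pi x n]] A.
  move=> _ [pi ->]; have [x Ax] := lo pi; apply: (le_trans Ax).
  apply: ub_le_sup; last by exists x.
  by exists n%:R => _ [x' ->]; exact: regret_le_rounds.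
apply/andP; split.
  by apply: lb_le_inf => //; eexists; exists pi0.
have [x0 _] := lo pi0.
apply: le_trans (ge_sup _ _).
- by apply: ge_inf; [exists A | exists pi0].
- by exists (regret L S pi0 x0 n), x0.
- by move=> _ [x ->]; exact: hi.
Qed.

End Regret.

(** * Exp3 on estimated losses *)

Section Exp3.
Context {R : realType} {Sig : Type} (eta : R) (y : 'I_2 -> Sig -> R).
Implicit Types (G : 'I_2 -> R).

Definition exp3_weight G a := expR (- eta * G a).
Definition exp3_total G := \sum_(a : 'I_2) exp3_weight G a.
Definition exp3_prob G a := exp3_weight G a / exp3_total G.
Definition exp3_step G (o : 'I_2 * Sig) : 'I_2 -> R :=
  fun b => G b + (b == o.1)%:R * (y o.1 o.2 / exp3_prob G o.1).
Definition exp3_estimate (h : seq ('I_2 * Sig)) := foldl exp3_step (fun=> 0) h.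
(** A smooth maximum over [a] of [G b - G a], the usual potential of exponential weights. *)
Definition exp3_potential b G := ln (exp3_total G) / eta + G b.

Lemma exp3_weight_gt0 G a : 0 < exp3_weight G a. Proof. exact: expR_gt0. Qed.

Lemma exp3_weight_le_total G a : exp3_weight G a <= exp3_total G.
Proof.
rewrite /exp3_total (bigD1 a)//= lerDl.
by apply: sumr_ge0 => b _; rewrite ltW ?exp3_weight_gt0.
Qed.

Lemma exp3_total_gt0 G : 0 < exp3_total G.
Proof. exact: lt_le_trans (exp3_weight_gt0 G ord0) (exp3_weight_le_total G ord0). Qed.

Lemma exp3_prob_gt0 G a : 0 < exp3_prob G a.
Proof. by rewrite divr_gt0 ?exp3_weight_gt0 ?exp3_total_gt0. Qed.

Lemma exp3_prob_ge0 G a : 0 <= exp3_prob G a.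
Proof. by rewrite ltW ?exp3_prob_gt0. Qed.

Lemma exp3_prob_sum1 G : \sum_(a : 'I_2) exp3_prob G a = 1.
Proof. by rewrite -mulr_suml mulfV// gt_eqF ?exp3_total_gt0. Qed.

Definition exp3 : learner R Sig :=
  Learner (fun h => exp3_prob_ge0 (exp3_estimate h))
          (fun h => exp3_prob_sum1 (exp3_estimate h)).

(** Combines [expR u >= 1 + u] with [(1 - u + u ^+ 2) * (1 + u) = 1 + u ^+ 3]. *)
Lemma expRN_le (u : R) : 0 <= u -> expR (- u) <= 1 - u + u ^+ 2.
Proof.
move=> u0; rewrite expRN; have u1 : 0 < 1 + u by lra.
apply: (@le_trans _ _ (1 + u)^-1).
  by rewrite lef_pV2 ?posrE ?expR_gt0// expR_ge1Dx.
rewrite -[_^-1]mul1r ler_pdivrMr//.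
have : 0 <= u * (u * u) by rewrite !mulr_ge0.
by rewrite (_ : (1 - u + u ^+ 2) * (1 + u) = 1 + u * (u * u)); [lra|ring].
Qed.

Hypothesis eta_gt0 : 0 < eta.
Hypothesis y01 : forall a s, 0 <= y a s <= 1.

(** Only the weight of [a], a fraction [p] of the total, changes. The total is thus multiplied by
    [1 + p * (expR (- u) - 1)], at most [expR (p * (- u + u ^+ 2))]. *)
Lemma exp3_total_step G a s :
  exp3_total (exp3_step G (a, s)) <=
  exp3_total G * expR (- eta * y a s + eta ^+ 2 * y a s ^+ 2 / exp3_prob G a).
Proof.
have p0 := exp3_prob_gt0 G a; have W0 := exp3_total_gt0 G.
set p := exp3_prob G a in p0 *; set u := eta * y a s / p.
have u0 : 0 <= u.
  have /andP[y0 _] := y01 a s.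
  by apply: divr_ge0; [apply: mulr_ge0; [exact: ltW|] | exact: ltW].
have -> : exp3_total (exp3_step G (a, s)) =
    exp3_total G + exp3_weight G a * (expR (- u) - 1).
  rewrite /exp3_total (bigD1 a)//= [in RHS](bigD1 a)//=.
  have -> : exp3_weight (exp3_step G (a, s)) a = exp3_weight G a * expR (- u).
    rewrite /exp3_weight /exp3_step /= eqxx mul1r -expRD; congr expR.
    by rewrite -/p /u; ring.
  have -> : \sum_(i < 2 | i != a) exp3_weight (exp3_step G (a, s)) i =
      \sum_(i < 2 | i != a) exp3_weight G i.
    apply: eq_bigr => i ia.
    by rewrite /exp3_weight /exp3_step /= (negPf ia) mul0r addr0.
  by ring.
have -> : exp3_weight G a = exp3_total G * p.
  by rewrite /p /exp3_prob mulrC divfK ?gt_eqF.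
rewrite -mulrA -[X in X + _]mulr1 -mulrDr ler_wpM2l ?(ltW W0)//.
apply: le_trans (expR_ge1Dx _); rewrite lerD2l.
apply: (@le_trans _ _ (p * (- u + u ^+ 2))).
  by rewrite ler_wpM2l ?(ltW p0)//; have := expRN_le _ u0; lra.
by rewrite le_eqVlt; apply/orP; left; apply/eqP; rewrite /u; field; rewrite gt_eqF.
Qed.

(* The variance factor [1 / p_a] of the importance-weighted estimate is
   cancelled by the probability of playing [a]. *)
Lemma exp3_potential_step b G a s :
  exp3_prob G a * exp3_potential b (exp3_step G (a, s)) <=
  exp3_prob G a * exp3_potential b G - exp3_prob G a * y a s + eta
  + (b == a)%:R * y a s.
Proof.
have p0 := exp3_prob_gt0 G a.
have lnW : ln (exp3_total (exp3_step G (a, s))) <=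
    ln (exp3_total G) + (- eta * y a s + eta ^+ 2 * y a s ^+ 2 / exp3_prob G a).
  rewrite -[X in _ + X]expRK -lnM ?posrE ?exp3_total_gt0 ?expR_gt0//.
  by rewrite ler_ln ?posrE ?mulr_gt0 ?exp3_total_gt0 ?expR_gt0// exp3_total_step.
rewrite /exp3_potential {2}/exp3_step /=; set p := exp3_prob G a in p0 lnW *.
have y2 : y a s ^+ 2 <= 1 by have /andP[? ?] := y01 a s; rewrite expr_le1.
apply: (@le_trans _ _ (p * ((ln (exp3_total G) +
   (- eta * y a s + eta ^+ 2 * y a s ^+ 2 / p)) / eta +
   (G b + (b == a)%:R * (y a s / p))))).
  by rewrite ler_wpM2l ?(ltW p0)// lerD2r ler_wpM2r ?invr_ge0 ?(ltW eta_gt0).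
have -> : p * ((ln (exp3_total G) +
   (- eta * y a s + eta ^+ 2 * y a s ^+ 2 / p)) / eta +
   (G b + (b == a)%:R * (y a s / p))) =
   p * (ln (exp3_total G) / eta + G b) - p * y a s + eta * y a s ^+ 2 +
   (b == a)%:R * y a s.
  by field; rewrite !gt_eqF.
by rewrite lerD2r lerD2l -[leRHS]mulr1 ler_wpM2l ?(ltW eta_gt0).
Qed.

Lemma exp3_potential_ge0 b G : 0 <= exp3_potential b G.
Proof.
rewrite /exp3_potential -lerBlDr sub0r ler_pdivlMr//.
rewrite (_ : - G b * eta = ln (exp3_weight G b)); last by rewrite expRK; ring.
by rewrite ler_ln ?posrE ?exp3_weight_gt0 ?exp3_total_gt0 ?exp3_weight_le_total.
Qed.

Context (L : 'I_2 -> nat -> R) (S : 'I_2 -> nat -> Sig) (F c : R).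
Hypothesis F_ge0 : 0 <= F.
Hypothesis estimable : forall a b z,
  L a z - L b z <= F * (y a (S a z) - y b (S b z)) + c.

(** Induction on the remaining rounds, for every history. [estimable] trades loss gaps for gaps of
    [y], and each of the two actions costs one [eta] per round. *)
Lemma exp3_cumloss b (x : nat -> fdist R) m t h :
  cumloss L S exp3 x m t h - \sum_(i < m) lossK L b (x (t + i)%N) <=
  F * (exp3_potential b (exp3_estimate h) + m%:R * (2 * eta)) + m%:R * c.
Proof.
elim: m t h => [|m IH] t h.
  by rewrite big_ord0 !mul0r subr0 !addr0 mulr_ge0 ?exp3_potential_ge0.
rewrite big_ord_recl addn0 /=.
have -> : \sum_(i < m) lossK L b (x (t + bump 0 i)%N) =
    \sum_(i < m) lossK L b (x (t.+1 + i)%N).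
  by apply: eq_bigr => i _; rewrite /bump leq0n addnA addn1.
set T := \sum_(i < m) _; set G := exp3_estimate h.
set Yb := fexp (x t) (fun z => y b (S b z)).
(* Summed over [a], the right side of [stepa] is [K + F * Yb + 2 * (F * eta)], the bound to be
   proved. *)
set K := F * (exp3_potential b G + m%:R * (2 * eta)) + m.+1%:R * c - F * Yb.
rewrite -[X in _ - X]mul1r -[X in _ - X * _](exp3_prob_sum1 G) mulr_suml -sumrB.
have stepa (a : 'I_2) : exp3_prob G a * (lossK L a (x t) + fexp (x t)
     (fun z => cumloss L S exp3 x m t.+1 (rcons h (a, S a z)))) -
   exp3_prob G a * (lossK L b (x t) + T) <=
   exp3_prob G a * K + (b == a)%:R * (F * Yb) + F * eta.
  have p0 := exp3_prob_ge0 G a; set p := exp3_prob G a in p0 *.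
  apply: (@le_trans _ _ (fexp (x t) (fun z =>
    p * (K + F * Yb) + F * eta + (b == a)%:R * F * y b (S b z) +
      - (p * F) * y b (S b z)))); last first.
    rewrite !fexpD !fexpZ !fexp_cst -/Yb; lra.
  have -> : p * (lossK L a (x t) + fexp (x t)
     (fun z => cumloss L S exp3 x m t.+1 (rcons h (a, S a z)))) -
     p * (lossK L b (x t) + T) = fexp (x t) (fun z =>
     p * L a z + p * cumloss L S exp3 x m t.+1 (rcons h (a, S a z)) +
     (- p) * L b z + (- (p * T))).
    by rewrite !fexpD !fexpZ fexp_cst /lossK; ring.
  apply: fexp_le => z.
  have := IH t.+1 (rcons h (a, S a z)).
  rewrite /exp3_estimate foldl_rcons -/(exp3_estimate h) -/G -/T => IHz.
  have := ler_wpM2l p0 (lerD IHz (estimable a b z)).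
  have := ler_wpM2l F_ge0 (exp3_potential_step b G a (S a z)).
  rewrite -/p => H1 H2.
  have -> : (b == a)%:R * F * y b (S b z) = F * ((b == a)%:R * y a (S a z)).
    by case: eqP => [->|_]; [rewrite !mul1r | rewrite !mul0r mulr0].
  rewrite /K -natr1; lra.
apply: le_trans (ler_sum _ (fun a _ => stepa a)) _.
rewrite !big_split /= -mulr_suml exp3_prob_sum1 -mulr_suml.
have -> : \sum_(a < 2) (b == a)%:R = 1 :> R.
  rewrite (bigD1 b)//= eqxx big1 ?addr0// => a ab.
  by rewrite eq_sym (negPf ab).
rewrite big_const_ord iter_addr_0 /K -!natr1; lra.
Qed.

Lemma regret_exp3 (x : nat -> fdist R) n :
  regret L S exp3 x n <= F * (eta^-1 + n%:R * (2 * eta)) + n%:R * c.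
Proof.
apply: regret_le => b; apply: le_trans (exp3_cumloss b x n 0 [::]) _.
rewrite lerD2r ler_wpM2l// lerD2r /exp3_potential /exp3_estimate /= addr0.
rewrite -[leRHS]mul1r ler_wpM2r ?invr_ge0 ?(ltW eta_gt0)//.
have -> : exp3_total (fun=> 0) = 1 + 1.
  by rewrite /exp3_total /exp3_weight mulr0 expR0 big_const_ord /= addr0.
by rewrite le_ln1Dx// (lt_trans _ (@ltr01 R))// ltrN10.
Qed.

End Exp3.

(** * Le Cam's two-point argument *)

Section TwoPoint.
Context {R : realType} {Sig : Type} (L : 'I_2 -> nat -> R) (S : 'I_2 -> nat -> Sig).
Context (pi : learner R Sig) (x0 x1 : fdist R) (c g rho lam : R).
Hypotheses (g_ge0 : 0 <= g) (rho_ge0 : 0 <= rho) (rho_le1 : rho <= 1) (lam_ge0 : 0 <= lam).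
Hypothesis loss0 : forall a, lossK L a x0 = c + g * (a == ord0)%:R.
Hypothesis loss1 : forall a, lossK L a x1 = c + g * (a == ord_max)%:R.
(* With [al ^+ 2] and [be ^+ 2] the likelihoods of the history so far under
   the two environments, this says that for either action the Bhattacharyya
   coefficient of the two signal distributions is at least [rho]. *)
Hypothesis affinity : forall a (G0 G1 : Sig -> R) K C, 0 <= K ->
  (forall s al be, 0 <= al -> 0 <= be ->
     K * (al * be) - C * (al ^+ 2 + be ^+ 2) <= al ^+ 2 * G0 s + be ^+ 2 * G1 s) ->
  forall al be, 0 <= al -> 0 <= be ->
     K * rho * (al * be) - C * (al ^+ 2 + be ^+ 2) <=
     al ^+ 2 * fexp x0 (fun z => G0 (S a z)) + be ^+ 2 * fexp x1 (fun z => G1 (S a z)).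

(* [lam] linearises Le Cam's bound [sum min(P, Q) >= (sum sqrt(P Q)) ^ 2 / 2]
   so that it can be proved by induction on the number of rounds. *)
Lemma two_point_cumloss m t h al be : 0 <= al -> 0 <= be ->
  g * m%:R * (2 * lam * rho ^+ m * (al * be) - lam ^+ 2 * (al ^+ 2 + be ^+ 2)) <=
  al ^+ 2 * (cumloss L S pi (fun=> x0) m t h - m%:R * c) +
  be ^+ 2 * (cumloss L S pi (fun=> x1) m t h - m%:R * c).
Proof.
elim: m t h al be => [|m IH] t h al be al0 be0.
  by rewrite mulr0 !mul0r subrr !mulr0 addr0.
set V0 := fun h' => cumloss L S pi (fun=> x0) m t.+1 h' - m%:R * c.
set V1 := fun h' => cumloss L S pi (fun=> x1) m t.+1 h' - m%:R * c.
have cumE (x : fdist R) (l : 'I_2) :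
    (forall a, lossK L a x = c + g * (a == l)%:R) ->
    cumloss L S pi (fun=> x) m.+1 t h - m.+1%:R * c =
    \sum_(a < 2) pi h a * (g * (a == l)%:R +
      fexp x (fun z => cumloss L S pi (fun=> x) m t.+1 (rcons h (a, S a z)) - m%:R * c)).
  move=> lossx /=; rewrite -[X in _ - X]mul1r -[X in _ - X * _](pol_sum1 pi h) mulr_suml -sumrB.
  by apply: eq_bigr => a _; rewrite lossx fexpD fexp_cst -natr1; ring.
rewrite (cumE _ _ loss0) (cumE _ _ loss1) !mulr_sumr -big_split /=.
rewrite -[leLHS]mul1r -[X in _ <= X]mul1r -[X in X * _ <= _](pol_sum1 pi h) mulr_suml mul1r.
apply: ler_sum => a _.
rewrite !(mulrCA _ (pi h a)) -mulrDr ler_wpM2l ?pol_ge0//.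
have rm : 0 <= rho ^+ m.+1 by rewrite exprn_ge0.
have rm1 : rho ^+ m.+1 <= 1 by rewrite exprn_ile1.
(* Exactly one environment charges [g] for [a]. If it is the first, [al ^+ 2] exceeds the bracket
   without [rho] by at least [(al - lam * be) ^+ 2]. *)
have now : g * (2 * lam * rho ^+ m.+1 * (al * be) - lam ^+ 2 * (al ^+ 2 + be ^+ 2)) <=
    g * (al ^+ 2 * (a == ord0)%:R + be ^+ 2 * (a == ord_max)%:R).
  rewrite ler_wpM2l//; apply: (@le_trans _ _ (2 * lam * (al * be) - lam ^+ 2 * (al ^+ 2 + be ^+ 2))).
    by rewrite lerD2r -[leRHS]mulr1 mulrAC ler_wpM2l ?mulr_ge0.
  have := sqr_ge0 (al - lam * be); have := sqr_ge0 (be - lam * al).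
  have := sqr_ge0 (lam * al); have := sqr_ge0 (lam * be).
  have [->|a1] := eqVneq a ord0.
    by rewrite (_ : (ord0 == ord_max :> 'I_2) = false)// mulr1 mulr0; lra.
  by rewrite (_ : a = ord_max) ?eqxx ?mulr1 ?mulr0; [lra | apply/val_inj; case: a a1 => [[|[]]]].
have K0 : 0 <= g * m%:R * (2 * lam * rho ^+ m) by rewrite !mulr_ge0 ?exprn_ge0.
(* The induction hypothesis has the form that [affinity] averages over the signal, at the cost of
   one factor [rho]. *)
have := affinity a (fun s => V0 (rcons h (a, s))) (fun s => V1 (rcons h (a, s)))
  _ (g * m%:R * lam ^+ 2) K0 _ _ _ al0 be0.
move=> /(_ _)/wrap[].
  move=> s al' be' al'0 be'0; apply: le_trans (IH t.+1 (rcons h (a, s)) _ _ al'0 be'0).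
  by lra.
rewrite /V0 /V1 => later.
have := lerD now later; congr (_ <= _); rewrite ?exprS -?natr1; ring.
Qed.

(** At [al = be = 1] the two regrets sum to at least [g * n * (lam - 2 * lam ^+ 2)]. This is largest
    at [lam = 1 / 4], where it is [g * n / 8]; one regret is at least half of it. *)
Lemma two_point_regret n : (0 < n)%N -> 1 / 2 <= rho ^+ n ->
  lam = 1 / 4 ->
  exists x : nat -> fdist R, g * n%:R / 16 <= regret L S pi x n.
Proof.
move=> n0 rn lamE.
have regE (x : fdist R) (l : 'I_2) :
    (forall a, lossK L a x = c + g * (a == l)%:R) ->
    cumloss L S pi (fun=> x) n 0 [::] - n%:R * c <= regret L S pi (fun=> x) n.
  move=> lossx; rewrite regretE lerD2l lerN2 min2E.
  rewrite !sumr_const !card_ord !lossx ge_min.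
  have [->|l0] := eqVneq l ord0.
    by apply/orP; right; rewrite mulr0 addr0 mulr_natl.
  by apply/orP; left; rewrite mulr0 addr0 mulr_natl.
have := two_point_cumloss n 0 [::] _ _ ler01 ler01.
have := regE _ _ loss0; have := regE _ _ loss1.
rewrite !expr1n !mul1r mulr1 lamE => h1 h0 h.
have gn : 0 <= g * n%:R by rewrite mulr_ge0.
have := ler_wpM2l gn rn => h2.
have [r0|r0] := leP (g * n%:R / 16) (regret L S pi (fun=> x0) n).
  by exists (fun=> x0).
by exists (fun=> x1); lra.
Qed.

End TwoPoint.

Lemma bernoulli (R : realFieldType) n (u : R) : 0 <= u -> u <= 1 ->
  1 - n%:R * u <= (1 - u) ^+ n.
Proof.
move=> u0 u1; elim: n => [|n IH]; first by rewrite expr0 mul0r subr0.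
rewrite [leRHS]exprS -natr1; have u1' : 0 <= 1 - u by rewrite subr_ge0.
have := ler_wpM2l u1' IH; have : 0 <= n%:R * (u * u) by rewrite !mulr_ge0.
lra.
Qed.

(** * The ladder game and the growth of its rungs *)

Section Ladder.
Context {R : realType} (beta : R).
Hypotheses (beta_gt0 : 0 < beta) (beta_lt1 : beta < 1).

Definition height (i : nat) : R := i%:R `^ beta.
(** As [0.-1 = 0], [rung 0] vanishes and outcome [0] costs neither action anything. *)
Definition rung (i : nat) : R := height i - height i.-1.

(* Outcomes [2 i + 1] and [2 i + 2] form the pair with loss gap [rung i.+1].
   Both give signal [i.+1] to action 1, and [i] resp. [i.+1] to action 0. *)
Definition ladder_loss (a : 'I_2) (z : nat) : R :=
  if odd z (+) (a == ord_max) then rung (uphalf z) else 0.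
Definition ladder_signal (a : 'I_2) (z : nat) : nat :=
  if a == ord0 then z./2 else uphalf z.

Lemma height0 : height 0 = 0.
Proof. by rewrite /height powR0// gt_eqF. Qed.

Lemma height_ge0 i : 0 <= height i. Proof. exact: powR_ge0. Qed.

Lemma height_gt0 i : (0 < i)%N -> 0 < height i.
Proof. by move=> i0; rewrite powR_gt0// ltr0n. Qed.

Lemma height_le i j : (i <= j)%N -> height i <= height j.
Proof.
by move=> ij; rewrite ge0_ler_powR ?nnegrE ?ler0n ?ler_nat// ltW.
Qed.

Lemma rung_ge0 i : 0 <= rung i.
Proof. by rewrite subr_ge0 height_le ?leq_pred. Qed.

(** Since [j / i >= 1] and [beta < 1], the power [beta] of this ratio is at most the ratio. *)
Lemma height_le_mul i j : (0 < i)%N -> (i <= j)%N ->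
  height j <= height i * (j%:R / i%:R).
Proof.
move=> i0 ij; have i0R : 0 < i%:R :> R by rewrite ltr0n.
have jE : j%:R = i%:R * (j%:R / i%:R) :> R by rewrite mulrC divfK ?gt_eqF.
rewrite /height [in leLHS]jE powRM ?divr_ge0//.
rewrite ler_wpM2l ?powR_ge0// ler1_powR ?(ltW beta_lt1)//.
by rewrite ler_pdivlMr// mul1r ler_nat.
Qed.

(** [height_le_mul] bounds the rung after [j] by [height j / j], and also shows that this quotient
    decreases from [N] on. *)
Lemma rung_le N j : (0 < N)%N -> (N < j)%N -> rung j <= height N / N%:R.
Proof.
case: j => // j N0; rewrite ltnS => Nj; rewrite /rung /=.
have j0 : (0 < j)%N by exact: leq_trans Nj.
have N0R : 0 < N%:R :> R by rewrite ltr0n.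
have j0R : 0 < j%:R :> R by rewrite ltr0n.
have h1 := height_le_mul j j.+1 j0 (leqnSn j).
have h2 := height_le_mul _ _ N0 Nj.
apply: (@le_trans _ _ (height j / j%:R)).
  rewrite lerBlDl; apply: le_trans h1 _; rewrite le_eqVlt; apply/orP; left.
  by apply/eqP; rewrite -natr1; field; rewrite gt_eqF.
by rewrite ler_pdivrMr// -mulrA [N%:R^-1 * _]mulrC.
Qed.

Lemma rung_le1 i : rung i <= 1.
Proof.
case: i => [|[|i]]; first by rewrite /rung subrr.
  by rewrite /rung /= height0 subr0 /height powR1.
apply: le_trans (rung_le 1 _ isT _) _ => //.
by rewrite /height powR1 divr1.
Qed.

Lemma ladder_loss01 a z : 0 <= ladder_loss a z <= 1.
Proof. by rewrite /ladder_loss; case: ifP; rewrite ?lexx ?ler01 ?rung_ge0 ?rung_le1. Qed.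

(** * Upper bound by truncated telescoping *)

Section Upper.
Variable N : nat.
Hypothesis N_gt0 : (0 < N)%N.

(* Without truncation the telescoping sums make [2 height N] times the
   difference of the two estimators equal to the loss difference, but they are
   unbounded. Truncating at [N] costs a bias of [rung j <= N `^ (beta - 1)] for
   [N < j]. *)
Let trunc i := height (minn i N).

(** Action 0 subtracts a truncated height twice, action 1 two neighbouring ones. On each outcome the
    numerators thus differ by one truncated rung, with the sign of the loss gap. *)
Definition ladder_estimator (a : 'I_2) (i : nat) : R :=
  (2 * height N - trunc i - trunc (if a == ord0 then i else i.-1)) / (2 * height N).

Let trunc_bounds i : 0 <= trunc i <= height N.
Proof. by rewrite height_ge0 height_le ?geq_minr. Qed.

Lemma ladder_estimator01 a i : 0 <= ladder_estimator a i <= 1.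
Proof.
have hN := height_gt0 _ N_gt0.
have /andP[t0 t1] := trunc_bounds i.
have /andP[u0 u1] := trunc_bounds (if a == ord0 then i else i.-1).
rewrite /ladder_estimator ler_pdivlMr ?ler_pdivrMr ?mulr_gt0//.
by apply/andP; split; lra.
Qed.

Lemma rung_trunc j :
  trunc j - trunc j.-1 <= rung j <= trunc j - trunc j.-1 + height N / N%:R.
Proof.
have c0 : 0 <= height N / N%:R by rewrite divr_ge0 ?height_ge0.
have [jN|Nj] := leqP j N.
  rewrite /trunc (minn_idPl jN) (minn_idPl (leq_trans (leq_pred j) jN)).
  by rewrite lexx /= lerDl.
rewrite /trunc (minn_idPr (ltnW Nj)) (minn_idPr _); last by case: j Nj.
by rewrite subrr rung_ge0 add0r rung_le.
Qed.

Lemma ladder_estimable a b z :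
  ladder_loss a z - ladder_loss b z <=
  2 * height N * (ladder_estimator a (ladder_signal a z) -
                  ladder_estimator b (ladder_signal b z)) + height N / N%:R.
Proof.
have hN := height_gt0 _ N_gt0.
have F0 : 2 * height N != 0 by rewrite mulf_neq0 ?gt_eqF.
rewrite /ladder_estimator -mulrBl mulrC divfK//.
have c0 : 0 <= height N / N%:R by rewrite divr_ge0 ?height_ge0.
have /andP[r1 r2] := rung_trunc (uphalf z).
have half0 : odd z -> (uphalf z).-1 = z./2 by rewrite uphalf_half => ->.
have half1 : odd z = false -> uphalf z = z./2 by rewrite uphalf_half => ->.
have ord2 (c : 'I_2) : c = ord0 \/ c = ord_max.
  by case: c => [[|[]]]// i; [left|right]; exact: val_inj.
rewrite /ladder_loss /ladder_signal.
have max0 : (ord_max == ord0 :> 'I_2) = false by [].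
have max1 : (ord0 == ord_max :> 'I_2) = false by [].
case: (boolP (odd z)) => oz; first rewrite (half0 oz) in r1 r2.
  by case: (ord2 a) => ->; case: (ord2 b) => ->; rewrite ?eqxx ?max0 ?max1 /= ?(half0 oz); lra.
rewrite (half1 (negPf oz)) in r1 r2 *.
by case: (ord2 a) => ->; case: (ord2 b) => ->; rewrite ?eqxx ?max0 ?max1 /=; lra.
Qed.

(** With [eta = 1 / N] and [n / N <= N], the three terms of [regret_exp3] are at most 2, 4 and 1
    times [N * height N]. *)
Lemma ladder_upper n : (n <= N ^ 2)%N ->
  exists pi : learner R nat, forall x,
    regret ladder_loss ladder_signal pi x n <= 7 * (N%:R * height N).
Proof.
move=> nN; have hN := height_gt0 _ N_gt0.
have N0 : 0 < N%:R :> R by rewrite ltr0n.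
have eta0 : 0 < N%:R^-1 :> R by rewrite invr_gt0.
exists (exp3 N%:R^-1 ladder_estimator) => x.
apply: le_trans (regret_exp3 _ _ eta0 ladder_estimator01 _ _ _ _ _ ladder_estimable _ _) _.
  by rewrite mulr_ge0 ?height_ge0.
rewrite invrK.
have nN' : n%:R / N%:R <= N%:R :> R.
  by rewrite ler_pdivrMr// -natrM ler_nat mulnn.
have := ler_wpM2l (height_ge0 N) nN'; lra.
Qed.

End Upper.

(** * Lower bound by two hardly distinguishable probes *)

Section Lower.
Variable m : nat.
Hypothesis m_gt0 : (0 < m)%N.

Let h : R := (2 * m%:R)^-1.

Let m_h : m%:R * h = 1 / 2.
Proof. by rewrite /h; field; rewrite pnatr_eq0 -lt0n. Qed.

Let h_gt0 : 0 < h.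
Proof. by rewrite invr_gt0 mulr_gt0 ?ltr0n. Qed.

Let h_le : h <= 1 / 2.
Proof. by rewrite -m_h ler_peMl ?(ltW h_gt0)// ler1n. Qed.

(* The masses on outcome [0] and on the pair [m] make the two ends of the
   ladder likely signals, so that the extra mass [h] that [b] moves from the
   one end to the other is hard to detect. *)
Definition probe_masses (b : bool) : seq (nat * R) :=
  [:: (0%N, 1 / 4), ((m.*2).+1, 1 / 8), ((m.*2).+2, 1 / 8) &
   [seq ((b + i.*2).+1, h) | i <- index_iota 0 m]].

Let sum_probe_masses b (f : nat -> R) :
  \sum_(i <- probe_masses b) i.2 * f i.1 =
  1 / 4 * f 0 + 1 / 8 * f (m.*2).+1 + 1 / 8 * f (m.*2).+2
  + h * \sum_(0 <= i < m) f (b + i.*2).+1.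
Proof. by rewrite /probe_masses !big_cons big_map -mulr_sumr /= !addrA. Qed.

Let probe_masses_ge0 b i : i \in probe_masses b -> 0 <= i.2.
Proof.
rewrite !inE => /or4P[/eqP->|/eqP->|/eqP->|/mapP[j _ ->]] //=; last exact: ltW.
Qed.

Let probe_masses_sum1 b : \sum_(i <- probe_masses b) i.2 = 1.
Proof.
under eq_bigr do rewrite -[_.2]mulr1.
rewrite (sum_probe_masses b (fun=> 1)) sumr_const_nat subn0.
have := m_h; rewrite -mulr_natl => mh; lra.
Qed.

Definition probe b : fdist R := mixture _ (probe_masses_ge0 b) (probe_masses_sum1 b).

Lemma fexp_probe b f : fexp (probe b) f =
  1 / 4 * f 0 + 1 / 8 * f (m.*2).+1 + 1 / 8 * f (m.*2).+2
  + h * \sum_(0 <= i < m) f (b + i.*2).+1.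
Proof. by rewrite fexp_mixture sum_probe_masses. Qed.

Lemma ladder_loss_pair a (b : bool) i :
  ladder_loss a (b + i.*2).+1 = ((a == ord_max) == b)%:R * (height i.+1 - height i).
Proof.
rewrite /ladder_loss /rung.
have -> : odd (b + i.*2).+1 = ~~ b by rewrite oddS oddD odd_double addbF oddb.
have -> : uphalf (b + i.*2).+1 = i.+1 by rewrite /= half_bit_double.
by case: (a == ord_max); case: b; rewrite ?mul1r ?mul0r.
Qed.

(** The rungs below [m] telescope to [height m], while the common mass on pair [m] charges both
    actions equally. *)
Lemma lossK_probe b a : lossK ladder_loss a (probe b) =
  rung m.+1 / 8 + h * height m * ((a == ord_max) == b)%:R.
Proof.
rewrite /lossK fexp_probe.
rewrite (ladder_loss_pair a false m) (ladder_loss_pair a true m).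
under eq_bigr do rewrite ladder_loss_pair.
rewrite -mulr_sumr telescope_sumr// height0 subr0 -/(rung m.+1).
have -> : ladder_loss a 0 = 0 by rewrite /ladder_loss /rung /= subrr if_same.
by case: (a == ord_max); case: b => /=; ring.
Qed.

(** For action 0 the probes differ only at signal [0], with masses [1 / 4 + h] and [1 / 4], and at
    signal [m], with masses [1 / 8] and [1 / 8 + h]. *)
Let probe_affinity_signal0 (G0 G1 : nat -> R) K C : 0 <= K ->
  (forall s al be, 0 <= al -> 0 <= be ->
     K * (al * be) - C * (al ^+ 2 + be ^+ 2) <= al ^+ 2 * G0 s + be ^+ 2 * G1 s) ->
  forall al be, 0 <= al -> 0 <= be ->
     K * (1 - 3 * h ^+ 2) * (al * be) - C * (al ^+ 2 + be ^+ 2) <=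
     al ^+ 2 * fexp (probe false) (fun z => G0 z./2) +
     be ^+ 2 * fexp (probe true) (fun z => G1 z./2).
Proof.
move=> K0 H al be al0 be0.
(* The contribution of one signal of masses [p] and [q], where [r] is a rational lower bound of the
   square root of [p * q]. *)
have H' p q r s : 0 <= p -> 0 <= q -> r ^+ 2 <= p * q ->
    K * (al * be) * r - C * (al ^+ 2 * p + be ^+ 2 * q) <=
    al ^+ 2 * p * G0 s + be ^+ 2 * q * G1 s.
  move=> p0 q0 rpq.
  have := H s (al * Num.sqrt p) (be * Num.sqrt q).
  rewrite !mulr_ge0 ?sqrtr_ge0// => /(_ isT isT).
  rewrite !exprMn !sqr_sqrtr//; apply: le_trans; rewrite lerD2r -!mulrA ler_wpM2l//.
  rewrite [Num.sqrt p * _]mulrCA ler_wpM2l// ler_wpM2l// -sqrtrM//.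
  by apply: le_trans (ler_norm _) _; rewrite -sqrtr_sqr ler_wsqrtr.
have h0 := ltW h_gt0; have hle := h_le.
have hh := ler_wpM2l h0 hle; have hhh := ler_wpM2l h0 hh; have hhhh := ler_wpM2l h0 hhh.
have hhh0 : 0 <= h * h * h by rewrite !mulr_ge0.
(* These three values of [r], with mass [1 / 2 - h] from the signals [1] to [m - 1], add up to
   [1 - 3 * h ^+ 2]. *)
have H1 := H' (1 / 4 + h) (1 / 4) (1 / 4 + h / 2 - h ^+ 2) 0%N.
have H2 := H' (1 / 8) (1 / 8 + h) (1 / 8 + h / 2 - 2 * h ^+ 2) m.
have H3 := H' (1 / 8) (1 / 8) (1 / 8) m.+1.
have {}H1 := H1 ltac:(lra) ltac:(lra) ltac:(lra).
have {}H2 := H2 ltac:(lra) ltac:(lra) ltac:(lra).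
have {}H3 := H3 ltac:(lra) ltac:(lra) ltac:(lra).
rewrite !fexp_probe.
have ends0 : ((m.*2).+1)./2 = m by rewrite -addn1 halfD odd_double /= doubleK addn0.
have ends1 : ((m.*2).+2)./2 = m.+1 by rewrite /= doubleK.
have mid0 i : ((false + i.*2).+1)./2 = i by rewrite add0n -addn1 halfD odd_double /= doubleK addn0.
have mid1 i : ((true + i.*2).+1)./2 = i.+1 by rewrite /= doubleK.
rewrite ends0 ends1.
under eq_bigr do rewrite mid0.
under [X in _ <= _ + _ * (_ + _ * X)]eq_bigr do rewrite mid1.
move: m_h H2 H3; case: (m) m_gt0 => // m' _ mh H2 H3.
(* Without signal [0] in the first sum and signal [m] in the second, both range over the same
   signals. *)
rewrite big_nat_recl// [X in _ <= _ + _ * (_ + _ * X)]big_nat_recr//=.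
set A := \sum_(_ <= _ < _) _; set B := \sum_(_ <= _ < _) _.
have H4 : m'%:R * (K * (al * be) - C * (al ^+ 2 + be ^+ 2)) <= al ^+ 2 * A + be ^+ 2 * B.
  rewrite mulr_natl -[X in _ *+ X](subn0 m') -sumr_const_nat !mulr_sumr -big_split /=.
  by apply: ler_sum => i _; exact: H.
have {}mh : h * m'%:R = 1 / 2 - h by rewrite -mh -natr1; ring.
have := ler_wpM2l h0 H4; rewrite [h * (m'%:R * _)]mulrA mh => {}H4.
lra.
Qed.

(** Both outcomes of a pair give action 1 the same signal, so it cannot tell the probes apart. *)
Let probe_affinity_signal1 (G0 G1 : nat -> R) K C : 0 <= K ->
  (forall s al be, 0 <= al -> 0 <= be ->
     K * (al * be) - C * (al ^+ 2 + be ^+ 2) <= al ^+ 2 * G0 s + be ^+ 2 * G1 s) ->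
  forall al be, 0 <= al -> 0 <= be ->
     K * (1 - 3 * h ^+ 2) * (al * be) - C * (al ^+ 2 + be ^+ 2) <=
     al ^+ 2 * fexp (probe false) (fun z => G0 (uphalf z)) +
     be ^+ 2 * fexp (probe true) (fun z => G1 (uphalf z)).
Proof.
move=> K0 H al be al0 be0.
apply: (@le_trans _ _ (K * (al * be) - C * (al ^+ 2 + be ^+ 2))).
  rewrite lerD2r -[leRHS]mulr1 mulrAC ler_wpM2l ?mulr_ge0//.
  by have := sqr_ge0 h; lra.
have signal b (G : nat -> R) : fexp (probe b) (fun z => G (uphalf z)) =
    fexp (probe false) (fun z => G (uphalf z)).
  have pair (c : bool) i : uphalf (c + i.*2).+1 = i.+1 by rewrite /= half_bit_double.
  by rewrite !fexp_probe; congr (_ + _ * _); apply: eq_bigr => i _; rewrite !pair.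
rewrite (signal true) -!fexpZ -fexpD -[leLHS](fexp_cst (probe false)).
by apply: fexp_le => z; exact: H.
Qed.

(** The bound [1 / 6] makes Bernoulli's inequality give [(1 - 3 * h ^+ 2) ^+ n >= 1 / 2]. *)
Lemma ladder_lower n (pi : learner R nat) : (0 < n)%N -> n%:R * h ^+ 2 <= 1 / 6 ->
  exists x : nat -> fdist R,
    h * height m * n%:R / 16 <= regret ladder_loss ladder_signal pi x n.
Proof.
move=> n0 nh.
have h20 : 0 <= h ^+ 2 := sqr_ge0 h.
have rho0 : 0 <= 1 - 3 * h ^+ 2.
  have : 1 * h ^+ 2 <= n%:R * h ^+ 2 by rewrite ler_wpM2r// ler1n.
  by lra.
apply: (two_point_regret _ _ _ (probe false) (probe true) (rung m.+1 / 8) _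
  (1 - 3 * h ^+ 2) (1 / 4)) => //.
- by rewrite mulr_ge0 ?height_ge0 ?(ltW h_gt0).
- by lra.
- move=> a; rewrite lossK_probe; congr (_ + _ * _%:R).
  by case: a => [[|[]]].
- by move=> a; rewrite lossK_probe eqb_id.
- move=> a; rewrite /ladder_signal.
  by case: (a == ord0); [exact: probe_affinity_signal0 | exact: probe_affinity_signal1].
by apply: le_trans (bernoulli _ n (3 * h ^+ 2) _ _); lra.
Qed.

End Lower.

(** * Matching rates and the exponent *)

Lemma exists_square_between n : (0 < n)%N -> exists k, (n <= k ^ 2 <= 4 * n)%N.
Proof.
elim: n => // -[_ _|n /(_ isT)[k /andP[nk kn]] _]; first by exists 1%N.
have [nk'|kn'] := leqP n.+2 (k ^ 2).
  by exists k; rewrite nk' (leq_trans kn)// leq_mul2l leqnSn orbT.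
exists k.+1; have {}kn' : (k ^ 2 = n.+1)%N by apply/eqP; rewrite eqn_leq -ltnS kn'.
move: kn'; rewrite -!mulnn => kn'; apply/andP; split; nia.
Qed.

Lemma ladder_minimax n : (0 < n)%N ->
  1 / 256 * n%:R `^ ((beta + 1) / 2) <= minimax_regret ladder_loss ladder_signal n
  <= 28 * n%:R `^ ((beta + 1) / 2).
Proof.
move=> n0; have [k /andP[nk kn]] := exists_square_between n n0.
have k0 : (0 < k)%N by case: k nk {kn} => //; rewrite leqNgt n0.
have k0R : 0 < k%:R :> R by rewrite ltr0n.
have hk := height_ge0 k.
have rateE : k%:R * height k = (k ^ 2)%:R `^ ((beta + 1) / 2).
  rewrite natrX -powR_mulrn// -powRrM (_ : 2%:R * ((beta + 1) / 2) = beta + 1); last by field.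
  by rewrite powRD ?(gt_eqF k0R) ?implybT// powRr1// mulrC.
set r := (beta + 1) / 2 in rateE *.
have r0 : 0 <= r by have := beta_gt0; rewrite /r; lra.
have r1 : r <= 1 by have := beta_lt1; rewrite /r; lra.
have rate_ge : n%:R `^ r <= k%:R * height k.
  by rewrite rateE ge0_ler_powR ?nnegrE ?ler_nat.
have rate_le : k%:R * height k <= 4 * n%:R `^ r.
  rewrite rateE; apply: (@le_trans _ _ ((4 * n)%:R `^ r)).
    by rewrite ge0_ler_powR ?nnegrE ?ler_nat.
  by rewrite natrM powRM// ler_wpM2r ?powR_ge0// ler1_powR// ler1n.
apply: minimax_regret_bounds => [|pi|].
- exact: ladder_loss01.
(* At depth [2 * k], [h = 1 / (4 * k)] and [n * h ^+ 2 <= 1 / 16]; depth [k] would only give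
   [1 / 4]. With [n >= k ^+ 2 / 4] the constant is [1 / (4 * 4 * 16)]. *)
- have kk0 : (0 < 2 * k)%N by rewrite muln_gt0.
  have nkR : n%:R <= k%:R ^+ 2 :> R by rewrite -natrX ler_nat.
  have knR : k%:R ^+ 2 <= 4 * n%:R :> R by rewrite -natrX -natrM ler_nat.
  have [|x xP] := ladder_lower (2 * k) kk0 n pi n0.
    rewrite exprVn natrM -ler_pdivlMr ?invr_gt0 ?exprn_gt0 ?mulr_gt0// invrK.
    have := sqr_ge0 (k%:R : R); lra.
  exists x; apply: le_trans xP.
  have h0 : 0 <= (2 * (2 * k)%:R)^-1 :> R by rewrite invr_ge0 mulr_ge0.
  apply: (@le_trans _ _ ((2 * (2 * k)%:R)^-1 * height k * (k%:R ^+ 2 / 4) / 16)).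
    rewrite natrM (_ : _^-1 * _ * _ / 16 = 1 / 256 * (k%:R * height k)).
      by rewrite ler_wpM2l.
    by field; rewrite gt_eqF.
  rewrite ler_wpM2r ?invr_ge0//; apply: ler_pM.
  + by rewrite mulr_ge0.
  + by rewrite divr_ge0 ?sqr_ge0.
  + by rewrite ler_wpM2l// height_le// leq_pmull.
  + by lra.
have [pi piP] := ladder_upper k k0 n nk.
by exists pi => x; apply: le_trans (piP x) _; lra.
Qed.

End Ladder.

(** Constant factors only add [ln c / ln n] and [ln C / ln n] to [q], and both vanish in the
    limit. *)
Lemma cvg_ln_ratio (R : realType) (u : nat -> R) (q c C : R) :
  0 < c -> 0 < C ->
  (forall n, (0 < n)%N -> c * n%:R `^ q <= u n <= C * n%:R `^ q) ->
  (fun n => ln (u n) / ln (n%:R : R)) @ \oo --> q.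
Proof.
move=> c0 C0 uq.
have lny : (ln (n%:R : R)) @[n --> \oo] --> +oo.
  apply/cvgryPge => A; near=> n.
  rewrite -[A]expRK ler_ln ?posrE ?expR_gt0//.
    by near: n; exact: nbhs_infty_ger.
  by rewrite ltr0n; near: n; exact: nbhs_infty_gt.
have lnV : (ln (n%:R : R))^-1 @[n --> \oo] --> (0 : R).
  apply/gtr0_cvgV0 => //; near=> n; rewrite ln_gt0// ltr1n.
  by near: n; exact: nbhs_infty_gt.
have bound (a : R) : (ln a * (ln (n%:R : R))^-1 + q) @[n --> \oo] --> q.
  rewrite -[X in _ --> X]add0r -[X in X + _](mulr0 (ln a)).
  by apply: cvgD; [apply: cvgM => //; exact: cvg_cst | exact: cvg_cst].
apply: squeeze_cvgr (bound c) (bound C); near=> n.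
have n1 : (1 < n)%N by near: n; exact: nbhs_infty_gt.
have n0 : (0 < n)%N := ltnW n1.
have ln0 : 0 < ln (n%:R : R) by rewrite ln_gt0// ltr1n.
have nq0 : 0 < (n%:R : R) `^ q by rewrite powR_gt0// ltr0n.
have lnE (a : R) : 0 < a -> ln a * (ln n%:R)^-1 + q = ln (a * n%:R `^ q) / ln n%:R.
  by move=> a0; rewrite lnM ?posrE// ln_powR mulrDl mulfK ?gt_eqF.
have /andP[lo hi] := uq n n0.
have u0 : 0 < u n by apply: lt_le_trans lo; rewrite mulr_gt0.
by rewrite !lnE// !ler_pM2r ?invr_gt0// !ler_ln ?posrE ?mulr_gt0// lo.
Unshelve. all: by end_near. Qed.

Theorem theorem4 (R : realType) (q : R) :
  2^-1 < q -> q < 1 ->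
  exists (Sig : Type) (L : 'I_2 -> nat -> R) (S : 'I_2 -> nat -> Sig),
    (forall a z, 0 <= L a z <= 1) /\
    (fun n : nat => ln (minimax_regret L S n) / ln (n%:R : R)) @ \oo --> q.
Proof.
move=> q_gt q_lt; have b0 : 0 < 2 * q - 1 by lra.
have b1 : 2 * q - 1 < 1 by lra.
exists nat, (ladder_loss (2 * q - 1)), ladder_signal; split.
  exact: ladder_loss01.
apply: (@cvg_ln_ratio _ _ _ (1 / 256) 28) => [||n n0]; [lra|lra|].
have := ladder_minimax _ b0 b1 _ n0.
by rewrite (_ : (2 * q - 1 + 1) / 2 = q); last by field.
Qed.
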